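(* Let $m\ge1$, let $w_1,\dots,w_m$ be nonzero real numbers with $W:=\sum_{k=1}^m|w_k|$, let $\varphi_1,\dots,\varphi_m$ be real numbers, and let $(r(n))_{n\ge0}$ be a real sequence with $r(n)=O(\omega^n)$ for some $0<\omega<1$. For $\bm{\theta}=(\theta_1,\dots,\theta_m)\in\mathbb{R}^m$ define \[ a(n):=\sum_{k=1}^m w_k\sin(n\theta_k+\varphi_k)+1+r(n),\qquad n\ge0. \] (i) If $W<1$, then for all $\bm{\theta}\in\mathbb{R}^m$ the sequence $(a(n))$ is positive for all sufficiently large $n$. (ii) If $W=1$, then for Lebesgue-almost all $\bm{\theta}\in\mathbb{R}^m$ the sequence $(a(n))$ is positive for all sufficiently large $n$. (iii) If $W>1$, then for Lebesgue-almost all $\bm{\theta}\in\mathbb{R}^m$ the sequence $(a(n))$ oscillates, i.e. $a(n)>0$ for infinitely many $n$ and $a(n)<0$ for infinitely many $n$. *)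

(* Defs.v *)
From HB Require Import structures.
From mathcomp Require Export all_boot all_order all_algebra.
From mathcomp Require Export all_classical all_reals all_analysis.

Set Implicit Arguments.
Unset Strict Implicit.
Unset Printing Implicit Defensive.

Export Order.TTheory GRing.Theory Num.Theory.
Export numFieldNormedType.Exports.

Local Open Scope classical_set_scope.
Local Open Scope ring_scope.

(* Lebesgue measure on the Borel sets of R^m, the points of R^m being m-tuples:
   the image of lebesgue_measure \x (Lebesgue measure on R^(m-1)) under the
   identification (x, t) |-> x :: t. The recursion is on bare set functions; that
   the result is a sigma-finite measure is the pair of instances on
   lebesgue_tuple, and lebesgue_tuple_box gives its value on boxes. *)
Fixpoint lebesgue_tuple (R : realType) (m : nat) :
    set (m.-tuple (measurableTypeR R)) -> \bar R :=
  match m with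
  | 0 => \d_([tuple] : 0.-tuple (measurableTypeR R))
  | m'.+1 => pushforward (lebesgue_measure \x lebesgue_tuple (m := m'))%E
      (fun p : measurableTypeR R * m'.-tuple (measurableTypeR R) =>
         [tuple of p.1 :: p.2])
  end.
Arguments lebesgue_tuple : clear implicits.

Section lebesgue_tuple_step.
Local Open Scope ereal_scope.
Context {R : realType} (m : nat).
Local Notation RR := (measurableTypeR R).
Variable mu : {sigma_finite_measure set (m.-tuple RR) -> \bar R}.

Let cons_pair (p : RR * m.-tuple RR) : m.+1.-tuple RR :=
  [tuple of p.1 :: p.2].

Let measurable_cons_pair : measurable_fun [set: RR * m.-tuple RR] cons_pair.
Proof. exact: measurable_cons. Qed.

Let step : set (m.+1.-tuple RR) -> \bar R :=
  pushforward (lebesgue_measure \x mu) cons_pair.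

Let step0 : step set0 = 0.
Proof. by rewrite /step /pushforward preimage_set0 measure0. Qed.

Let step_ge0 A : 0 <= step A.
Proof. exact: measure_ge0. Qed.

Let step_sigma_additive : semi_sigma_additive step.
Proof. exact: (@measure_semi_sigma_additive _ _ _ (pushforward _ _)). Qed.

HB.instance Definition _ := isMeasure.Build _ _ _ step
  step0 step_ge0 step_sigma_additive.

Let step_sigma_finite : sigma_finite setT step.
Proof.
have /sigma_finiteP[F [FT ndF Foo]] := sigma_finiteT (@lebesgue_measure R).
have /sigma_finiteP[G [GT ndG Goo]] := sigma_finiteT mu.
pose uncons (t : m.+1.-tuple RR) : RR * m.-tuple RR :=
  (thead t, [tuple of behead t]).
have muncons : measurable_fun setT uncons.
  by apply/measurable_fun_pair; [exact: measurable_tnth|exact: measurable_behead].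
have consK : uncons \o cons_pair = id.
  by apply/funext => -[x t]; rewrite /uncons/=; congr pair; exact/val_inj.
exists (fun n => uncons @^-1` (F n `*` G n)).
  apply/esym; rewrite -subTset => t _.
  have [i _ Fi] : (\bigcup_i F i) (uncons t).1 by rewrite -FT.
  have [j _ Gj] : (\bigcup_j G j) (uncons t).2 by rewrite -GT.
  exists (maxn i j) => //; split.
    by move: Fi; exact/subsetPset/ndF/leq_maxl.
  by move: Gj; exact/subsetPset/ndG/leq_maxr.
move=> n; have [mF Fn] := Foo n; have [mG Gn] := Goo n; split.
  by rewrite -[X in measurable X]setTI; apply: muncons => //; exact: measurableX.
rewrite /step /pushforward -comp_preimage consK preimage_id.
by rewrite product_measure1E// lte_mul_pinfty// ge0_fin_numE.
Qed.

HB.instance Definition _ :=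
  Measure_isSigmaFinite.Build _ _ _ step step_sigma_finite.

Lemma lebesgue_tuple_step_ex :
  exists nu : {sigma_finite_measure set (m.+1.-tuple RR) -> \bar R},
    (nu : set _ -> \bar R) = step.
Proof. by exists step. Qed.

End lebesgue_tuple_step.

Section lebesgue_tuple_measure.
Local Open Scope ereal_scope.
Context {R : realType}.
Local Notation RR := (measurableTypeR R).

Let lebesgue_tuple_ex m :
  exists nu : {sigma_finite_measure set (m.-tuple RR) -> \bar R},
    (nu : set _ -> \bar R) = lebesgue_tuple R m.
Proof.
elim: m => [|m [mu muE]] /=; first by exists \d_([tuple] : 0.-tuple RR).
by have [nu nuE] := lebesgue_tuple_step_ex mu; exists nu; rewrite nuE muE.
Qed.

Let lebesgue_tuple0 m : lebesgue_tuple R m set0 = 0.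
Proof. by have [nu <-] := lebesgue_tuple_ex m; exact: measure0. Qed.

Let lebesgue_tuple_ge0 m A : 0 <= lebesgue_tuple R m A.
Proof. by have [nu <-] := lebesgue_tuple_ex m; exact: measure_ge0. Qed.

Let lebesgue_tuple_sigma_additive m : semi_sigma_additive (lebesgue_tuple R m).
Proof.
by have [nu <-] := lebesgue_tuple_ex m; exact: measure_semi_sigma_additive.
Qed.

HB.instance Definition _ m := isMeasure.Build _ _ _ (lebesgue_tuple R m)
  (lebesgue_tuple0 m) (@lebesgue_tuple_ge0 m) (@lebesgue_tuple_sigma_additive m).

Let lebesgue_tuple_sigma_finite m : sigma_finite setT (lebesgue_tuple R m).
Proof. by have [nu <-] := lebesgue_tuple_ex m; exact: sigma_finiteT. Qed.

HB.instance Definition _ m := Measure_isSigmaFinite.Build _ _ _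
  (lebesgue_tuple R m) (lebesgue_tuple_sigma_finite m).

Lemma measurable_tuple_box m (A : 'I_m -> set RR) :
  (forall k, measurable (A k)) ->
  measurable [set t : m.-tuple RR | forall k, A k (tnth t k)].
Proof.
move=> mA.
rewrite (_ : [set _ | _] =
    \bigcap_(k in [set: 'I_m]) ((fun t : m.-tuple RR => tnth t k) @^-1` A k)).
  apply: fin_bigcap_measurable => // k _; rewrite -[X in measurable X]setTI.
  exact: measurable_tnth.
by apply/seteqP; split=> t /= At k; [move=> _|]; exact: At.
Qed.

Lemma lebesgue_tuple_box m (A : 'I_m -> set RR) :
  (forall k, measurable (A k)) ->
  lebesgue_tuple R m [set t | forall k, A k (tnth t k)] =
  \prod_(k < m) lebesgue_measure (A k).
Proof.
elim: m A => [|m IH] A mA.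
  by rewrite big_ord0/= diracE mem_set// => -[].
pose B := [set t : m.-tuple RR | forall k, A (lift ord0 k) (tnth t k)].
have mB : measurable B.
  by apply: (@measurable_tuple_box _ (fun k => A (lift ord0 k))) => k.
rewrite big_ord_recl -(IH (fun k => A (lift ord0 k)))//.
rewrite -(@product_measure1E _ _ _ _ _ lebesgue_measure (lebesgue_tuple R m) _ B)//.
rewrite /= /pushforward; congr (_ _).
apply/seteqP; split=> -[x t] /=.
  move=> H; split; first exact: (H ord0).
  by move=> k; have := H (lift ord0 k); rewrite (tnthS x t).
move=> [Hx Ht] k; case: (unliftP ord0 k) => [j ->|->//].
by rewrite (tnthS x t); exact: Ht.
Qed.

End lebesgue_tuple_measure.

Definition sine_sum_seq (R : realType) (m : nat) (w phi : 'I_m -> R)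
    (r : nat -> R) (theta : m.-tuple R) (n : nat) : R :=
  \sum_(k < m) w k * sin (n%:R * tnth theta k + phi k) + 1 + r n.

Definition oscillates (R : realType) (a : nat -> R) : Prop :=
  infinite_set [set n | 0 < a n] /\ infinite_set [set n | a n < 0].

(* Main.v *)
(* After absorbing signs and phases, the sum is
   [\sum_k |w_k| cos (n theta_k + psi_k)]. For (ii) it equals
   [\sum_k |w_k| (1 + cos (n theta_k + psi_k)) - 1], and by Borel-Cantelli, for
   almost every [theta_k], [1 + cos (n theta_k + psi_k)] is eventually larger than
   any given multiple of [omega ^ n]. For (iii) it suffices that for almost every
   [theta] all the cosines are simultaneously close to 1 infinitely often (apply
   this to [w] and to [- w]). One coordinate is handled by the Lebesgue density
   theorem, along an arbitrary infinite set of times; Fubini then gives all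
   coordinates without any appeal to Kronecker or Weyl. *)

Require Import Defs.
From mathcomp Require Import measurable_realfun ring lra.

Set Implicit Arguments.
Unset Strict Implicit.
Unset Printing Implicit Defensive.

Local Open Scope classical_set_scope.
Local Open Scope ring_scope.

(** * Phases and elementary bounds for sine and cosine *)

Section phase.
Context {R : realType}.
Implicit Types x y z d : R.

Lemma cosD_int2pi z (j : int) : cos (z + j%:~R * (pi *+ 2)) = cos z.
Proof.
have pos (n : nat) y : cos (y + n%:R * (pi *+ 2)) = cos y.
  by rewrite mulr_natl (periodicn (@cosD2pi R)).
case: j => n; first by rewrite -pmulrn pos.
rewrite NegzE mulrNz mulNr -pmulrn.
by rewrite -[in RHS](subrK (n.+1%:R * (pi *+ 2)) z) pos.
Qed.

Lemma dist_int2pi_le z : exists j : int, `|z - j%:~R * (pi *+ 2)| <= pi.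
Proof.
have pi0 : 0 < (pi : R) := pi_gt0 R.
(* Adding [pi] before dividing turns the floor into rounding to a nearest multiple of [2 pi]. *)
set q := (z + pi) / (pi *+ 2); have qE : q * (pi *+ 2) = z + pi.
  by rewrite mulfVK// mulrn_eq0/= gt_eqF.
exists (Num.floor q).
have := floor_le q; have := floorD1_gt q; rewrite intrD.
set f := (Num.floor q)%:~R => h1 h2.
rewrite ler_norml; nra.
Qed.

Lemma sin_amplitude_phase (w phi : R) :
  exists psi, forall y, w * sin (y + phi) = `|w| * cos (y + psi).
Proof.
have [w0|w0] := leP 0 w.
  by exists (phi - pi / 2) => y; rewrite ger0_norm// addrA cosBpihalf.
exists (phi + pi / 2) => y.
by rewrite ltr0_norm// addrA cosDpihalf mulrNN.
Qed.

Lemma sin_amplitude_phases m (w phi : 'I_m -> R) :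
  exists psi : 'I_m -> R,
    forall k y, w k * sin (y + phi k) = `|w k| * cos (y + psi k).
Proof.
have [psi psiP] := choice (fun k => sin_amplitude_phase (w k) (phi k)).
by exists psi.
Qed.

(** The cap [eta <= pi] later keeps an arc of half-width [eta / n] inside a ball of radius
    [2 pi / n]. *)
Lemma cos_gt_near0 d : 0 < d ->
  exists2 eta : R, 0 < eta <= pi & forall y, `|y| < eta -> 1 - d < cos y.
Proof.
move=> d0; have /cvgrPdist_lt/(_ d d0) := @continuous_cos R 0.
rewrite cos0 => /nbhs_ballP[e /= e0 He].
exists (Num.min e pi); first by rewrite lt_min e0 pi_gt0 ge_min lexx orbT.
move=> y; rewrite lt_min => /andP[ye _].
have /= := He y; rewrite /ball/= sub0r normrN => /(_ ye).
by rewrite ltr_norml => /andP[_]; lra.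
Qed.

Lemma sin_ge_linear : exists2 c : R, 0 < c &
  forall x, 0 <= x <= pi / 2 -> c * x <= sin x.
Proof.
have c1 := @cos1_gt0 R.
have p2 := @pihalf_lt2 R; have p1 := @pihalf_ge1 R; have pi0 := @pi_gt0 R.
have small x : 0 <= x <= 1 -> cos 1 * x <= sin x.
  move=> /andP[x0 x1].
  have [|y yx] := @MVT_segment _ sin cos 0 x x0.
    by apply: continuous_subspaceT => z; exact: continuous_sin.
  move: yx; rewrite in_itv/= => /andP[y0 yx].
  rewrite sin0 !subr0 => ->; apply: ler_wpM2r => //.
  rewrite leNgt ltr_cos ?in_itv/=; lra.
(* Up to 1 the mean value theorem gives slope [cos 1]; beyond 1, [sin x > sin 1 >= cos 1], and
   [x < 2] costs the factor 1/2. *)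
exists (cos 1 / 2); first lra.
move=> x /andP[x0 xp]; have [x1|x1] := leP x 1.
  by have := small x; rewrite x0 x1 => /(_ isT); nra.
have s1 := small 1; rewrite ler01 lexx in s1.
have : sin 1 < sin x by rewrite ltr_sin ?in_itv/=; lra.
by have := s1 isT; nra.
Qed.

(** By the half-angle formula [1 - cos x = 2 sin(x/2)^2], where [|x| / 2] is in the range of the
    linear bound for sine. *)
Lemma subr1_cos_ge_sqr : exists2 c : R, 0 < c &
  forall x, `|x| <= pi -> c * x ^+ 2 <= 1 - cos x.
Proof.
have [c c0 cP] := sin_ge_linear.
exists (c ^+ 2 / 2); first by rewrite divr_gt0// exprn_gt0.
move=> x xpi.
have -> : cos x = cos `|x| by have [_|//] := ler0P x; rewrite cosN.
rewrite -[x ^+ 2]real_normK ?num_real//.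
have y0 := normr_ge0 x; set y := `|x| in y0 xpi *.
have -> : cos y = 1 - sin (y / 2) ^+ 2 *+ 2.
  have {1}-> : y = (y / 2) *+ 2 by rewrite -mulr_natr; lra.
  by rewrite cos_mulr2n cos2sin2; ring.
have := cP (y / 2); rewrite divr_ge0//= ler_pM2r// => /(_ xpi).
set s := sin _; have : 0 <= c * (y / 2) by rewrite mulr_ge0 ?divr_ge0// ltW.
rewrite -mulr_natr; nra.
Qed.

End phase.

(** * Null sets on the line from Lebesgue density *)

Lemma measure_disjointD_le d (T : ringOfSetsType d) (R : realFieldType)
    (mu : {measure set T -> \bar R}) (A B C : set T) :
  measurable A -> measurable B -> measurable C ->
  A `<=` C -> B `<=` C -> (forall x, A x -> ~ B x) ->
  (mu A + mu B <= mu C)%E.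
Proof.
move=> mA mB mC AC BC AB; rewrite -measureU//.
  apply: le_measure; rewrite ?inE//; first exact: measurableU.
  by move=> x [/AC|/BC].
by apply/seteqP; split => // x [/AB].
Qed.

Section one_dimension.
Context {R : realType}.
Local Notation mu := (@lebesgue_measure R).

(* The ball of radius [2 pi / n] around any point contains a whole arc of
   length [2 eta / n] on which [cos (n y + psi) > 1 - d]; its complement thus
   misses a fixed proportion of that ball, so it has no density points. *)
Lemma null_cos_le (S : set nat) (psi d : R) (A : set R) :
  0 < d -> (forall N, exists2 n, (N <= n)%N & S n) ->
  measurable A ->
  (forall x n, A x -> S n -> cos (n%:R * x + psi) <= 1 - d) ->
  mu A = 0%E.
Proof.
move=> d0 infS mA A_le; apply: measure_negligible => //.
have [eta /andP[eta0 etapi] etaP] := cos_gt_near0 d0.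
have pi0 : 0 < (pi : R) := pi_gt0 R.
apply: (negligibleS _ (lebesgue_density mA)) => /= x Ax cvgx.
rewrite /= in cvgx.
(* This is [(2 r - 2 eta / n) / (2 r)] for [r = 2 pi / n], hence independent of [n]; density 1 at
   [x] would force ratios above it. *)
pose c : R := 1 - eta / (pi *+ 2).
have : nbhs (\1_A x)%:E [set y : \bar R | (c%:E < y)%E].
  apply: open_nbhs_nbhs; split; first exact: open_ereal_gt_ereal.
  rewrite /= indicE mem_set// lte_fin /c gtrBl divr_gt0//.
  by rewrite -mulr_natr mulr_gt0.
move=> /cvgx[/= e e0 He].
have [n nN Sn] := infS (Num.truncn (pi *+ 2 / e)).+1.
have n0 : 0 < n%:R :> R by rewrite ltr0n (leq_trans _ nN).
pose r : R := pi *+ 2 / n%:R.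
have r0 : 0 < r by rewrite divr_gt0// -mulr_natr mulr_gt0.
have re : r < e.
  rewrite ltr_pdivrMr// mulrC -ltr_pdivrMr//.
  by rewrite (lt_le_trans (truncnS_gt _))// ler_nat.
have : (c%:E < mu (A `&` ball x r) / mu (ball x r))%E.
  by apply: He => //=; rewrite sub0r normrN gtr0_norm.
have [j jP] := dist_int2pi_le (n%:R * x + psi).
(* The point with [n y + psi = 2 pi j], at distance at most [pi / n] from [x]. *)
pose y := x - (n%:R * x + psi - j%:~R * (pi *+ 2)) / n%:R.
have arcB : ball y (eta / n%:R) `<=` ball x r.
  move=> z; rewrite /ball/= => yz.
  have -> : x - z = (n%:R * x + psi - j%:~R * (pi *+ 2)) / n%:R + (y - z).
    by rewrite /y; ring.
  rewrite (le_lt_trans (ler_normD _ _))//.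
  rewrite normrM normfV (gtr0_norm n0) /r mulr2n mulrDl.
  apply: ler_ltD; first by rewrite ler_wpM2r// invr_ge0 ltW.
  by rewrite (lt_le_trans yz)// ler_wpM2r// invr_ge0 ltW.
have arcA : A `&` ball x r `<=` ball x r `\` ball y (eta / n%:R).
  move=> z [Az xz]; split => // yz.
  have := A_le z n Az Sn; apply/negP; rewrite -ltNge.
  have -> : n%:R * z + psi = n%:R * (z - y) + j%:~R * (pi *+ 2).
    by rewrite /y; field; rewrite gt_eqF.
  rewrite cosD_int2pi etaP// normrM gtr0_norm// mulrC -ltr_pdivlMr//.
  by rewrite distrC.
apply/negP; rewrite -leNgt.
have mB : mu (ball x r) = (r *+ 2)%:E by rewrite lebesgue_measure_ball// ltW.
have mArc : mu (ball y (eta / n%:R)) = (eta / n%:R *+ 2)%:E.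
  by rewrite lebesgue_measure_ball// divr_ge0// ltW.
have le : (mu (A `&` ball x r) <= (r *+ 2 - eta / n%:R *+ 2)%:E)%E.
  rewrite EFinB leeBrDr// -mB -mArc.
  apply: (measure_disjointD_le lebesgue_measure).
  - by apply: measurableI; [exact: mA|exact: measurable_ball].
  - exact: measurable_ball.
  - exact: measurable_ball.
  - by move=> z [].
  - exact: arcB.
  - by move=> z Az; have [] := arcA z Az.
rewrite mB inver mulrn_eq0/= gt_eqF//.
apply: (le_trans (lee_wpmul2r _ le)).
  by rewrite lee_fin invr_ge0 mulrn_wge0// ltW.
rewrite -EFinM lee_fin /c /r le_eqVlt; apply/orP; left; apply/eqP.
clear -pi0 n0; move: (pi : R) pi0 => p p0; field.
by rewrite !gt_eqF.
Qed.

End one_dimension.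

(** * Almost sure recurrence, on the line and then for tuples *)

Section recurrence.
Context {R : realType}.
Local Notation mu := (@lebesgue_measure R).

Lemma measurable_cos_gt (a b c : R) :
  measurable [set x : R | c < cos (a * x + b)].
Proof.
apply: open_measurable.
have : continuous (fun x : R => cos (a * x + b)).
  move=> x; apply: (@continuous_comp _ _ _ (fun x => a * x + b) cos).
    apply: (@cvgD _ R^o); last exact: cvg_cst.
    by apply: (@cvgM R); [exact: cvg_cst|exact: cvg_id].
  exact: continuous_cos.
by move=> /continuousP/(_ [set y | c < y]); apply; exact: open_gt.
Qed.

Lemma ae_cos_gt_io (S : set nat) (psi d : R) :
  0 < d -> (forall N, exists2 n, (N <= n)%N & S n) ->
  {ae mu, forall x, forall N, exists2 n, (N <= n)%N &
    S n /\ 1 - d < cos (n%:R * x + psi)}.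
Proof.
move=> d0 infS.
(* The points with no good time in [S] from [N] on; the tail of [S] is still infinite, so each [A N]
   is null. *)
pose A N : set R := \bigcap_(n in [set n | S n /\ (N <= n)%N])
  ~` [set x | 1 - d < cos (n%:R * x + psi)].
have mA N : measurable (A N).
  apply: bigcap_measurable.
    by have [n Nn Sn] := infS N; exists n.
  by move=> n _; apply: measurableC; exact: measurable_cos_gt.
have nullA N : mu (A N) = 0%E.
  apply: (@null_cos_le R [set n | S n /\ (N <= n)%N] psi d) => //.
  - move=> M; have [n] := infS (maxn M N); rewrite geq_max => /andP[Mn Nn] Sn.
    by exists n.
  - by move=> x n /(_ n) /[apply] /=; rewrite leNgt => /negP.
have negA : mu.-negligible (\bigcup_N A N).
  apply: negligible_bigcup => N; exists (A N).
  by split; [exact: mA|exact: nullA|].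
apply: (negligibleS _ negA).
move=> x /= /existsNP[N HN]; exists N => // n /= [Sn Nn] cn.
by apply: HN; exists n.
Qed.

(** Tonelli: the measure of [A] is the integral over [x] of the measures of its slices, and this
    integrand vanishes almost everywhere. *)
Lemma lebesgue_tuple_null m (A : set (m.+1.-tuple (measurableTypeR R))) :
  measurable A ->
  {ae mu, forall x, lebesgue_tuple R m [set t : m.-tuple _ |
    A [tuple of x :: t]] = 0%E} ->
  lebesgue_tuple R m.+1 A = 0%E.
Proof.
move=> mA A0; rewrite /= /pushforward /product_measure1.
set B := _ @^-1` A.
have mB : measurable B.
  by rewrite -[B]setTI; apply: measurable_cons.
rewrite -[RHS](integral0 mu setT).
apply: ge0_ae_eq_integral => //.
  exact: measurable_fun_xsection.
apply: filterS A0 => x /= A0 _; rewrite -[RHS]A0; congr (lebesgue_tuple R m _).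
by apply/seteqP; split => t /=; rewrite /xsection/= inE.
Qed.

Lemma measurable_tuple_cos_gt_io m (S : set nat) (psi : 'I_m -> R) (d : R) :
  measurable [set t : m.-tuple (measurableTypeR R) |
    forall N, exists2 n, (N <= n)%N &
      S n /\ forall k, 1 - d < cos (n%:R * tnth t k + psi k)].
Proof.
rewrite (_ : [set _ | _] = \bigcap_N \bigcup_(n in [set n | (N <= n)%N /\ S n])
    [set t : m.-tuple (measurableTypeR R) | forall k,
       [set x : R | 1 - d < cos (n%:R * x + psi k)] (tnth t k)]).
  apply: bigcapT_measurable => N; apply: bigcup_measurable => n _.
  apply: (measurable_tuple_box
    (A := fun k => [set x | 1 - d < cos (n%:R * x + psi k)])) => k.
  exact: measurable_cos_gt.
apply/seteqP; split => t /= Ht N.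
  by move=> _; have [n Nn [Sn Hn]] := Ht N; exists n.
by have [n [Nn Sn] Hn] := Ht N I; exists n.
Qed.

(* Fubini: after almost every choice of the first coordinate, the times at
   which it is good still form an infinite set, to which the induction
   hypothesis applies; this is why [S] is arbitrary. *)
Lemma ae_tuple_cos_gt_io m (S : set nat) (psi : 'I_m -> R) (d : R) :
  0 < d -> (forall N, exists2 n, (N <= n)%N & S n) ->
  {ae lebesgue_tuple R m, forall t : m.-tuple R,
    forall N, exists2 n, (N <= n)%N &
      S n /\ forall k, 1 - d < cos (n%:R * tnth t k + psi k)}.
Proof.
move=> d0; elim: m S psi => [|m IH] S psi infS.
  apply: aeW => t N; have [n Nn Sn] := infS N.
  by exists n => //; split => // -[].
apply/negligibleP.
  apply: measurableC; exact: measurable_tuple_cos_gt_io.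
apply: lebesgue_tuple_null.
  apply: measurableC; exact: measurable_tuple_cos_gt_io.
have := ae_cos_gt_io (psi ord0) d0 infS.
apply: filterS; first exact: (ae_filter_ringOfSetsType mu).
move=> x infSx.
have /negligibleP <- := IH [set n | S n /\ 1 - d < cos (n%:R * x + psi ord0)]
    (fun k => psi (lift ord0 k)) infSx; last first.
  apply: measurableC; exact: measurable_tuple_cos_gt_io.
congr (lebesgue_tuple R m _); apply/seteqP; split => t /=; apply: contra_not.
  move=> H N; have [n Nn [[Sn Hn] Hk]] := H N; exists n => //; split => // k.
  by case: (unliftP ord0 k) => [j|] ->//; rewrite tnthS; exact: Hk.
move=> H N; have [n Nn [Sn Hk]] := H N; exists n => //; split.
  by split => //; exact: (Hk ord0).
by move=> k; have := Hk (lift ord0 k); rewrite tnthS.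
Qed.

End recurrence.

(** * Borel-Cantelli for exponentially close approach *)

Section exponential_approach.
Context {R : realType}.
Local Notation mu := (@lebesgue_measure R).

Lemma nneseries_geometric_lty (u : nat -> \bar R) (a z : R) :
  (forall n, 0 <= u n)%E -> 0 <= a -> 0 < z -> z < 1 ->
  (forall n, u n <= (a * z ^+ n)%:E)%E -> (\sum_(n <oo) u n < +oo)%E.
Proof.
move=> u0 a0 z0 z1 ule; apply: (@le_lt_trans _ _ (a / (1 - z))%:E);
  last exact: ltry.
apply: lime_le; first by apply: is_cvg_nneseries => n _ _.
apply: nearW => n; apply: (@le_trans _ _ (series (geometric a z) n)%:E).
  by rewrite /series/= -sumEFin; apply: lee_sum => i _; exact: ule.
by rewrite lee_fin geometric_le_lim// gtr0_norm.
Qed.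

(* Where [1 + cos (n x + psi)] is at most [C omega ^ n], [n x + psi + pi] lies
   within [D rho ^ n] of a multiple [2 pi j], [rho] being [sqrt omega]; for [x]
   bounded only [O(n)] values of [j] occur, so Borel-Cantelli applies. *)
Lemma ae_cos_gt_geometric (psi C omega : R) :
  0 <= C -> 0 < omega -> omega < 1 ->
  {ae mu, forall x, \forall n \near \oo,
    C * omega ^+ n < 1 + cos (n%:R * x + psi)}.
Proof.
move=> C0 om0 om1; have pi0 : 0 < (pi : R) := pi_gt0 R.
have pi2 : 2 <= (pi : R) := pi_ge2 R.
have [c c0 cP] := @subr1_cos_ge_sqr R.
pose rho := Num.sqrt omega.
have rho0 : 0 < rho by rewrite sqrtr_gt0.
have rho1 : rho < 1 by rewrite -sqrtr1 ltr_sqrt.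
(* The [+ 1] makes [D] positive even if [C = 0] and makes the bound on [u] below strict, as open
   balls require. *)
pose D := Num.sqrt (C / c) + 1.
have D0 : 0 < D by rewrite ltr_wpDl ?sqrtr_ge0.
(* The solution of [n x + psi + pi = 2 pi j] for [j = i - K n]; the shift indexes [-K n <= j <= K n]
   by naturals. *)
pose ctr K n (i : nat) : R :=
  ((i%:R - (K * n)%:R) * (pi *+ 2) - psi - pi) / n%:R.
pose F K n : set R := \big[setU/set0]_(i < (K * n).*2.+1)
  ball (ctr K n i) (D * rho ^+ n / n%:R).
have mF K n : measurable (F K n).
  by apply: bigsetU_measurable => i _; exact: measurable_ball.
have Dn0 n : 0 <= D * rho ^+ n by rewrite mulr_ge0 ?exprn_ge0 ?ltW.
have muF K n : (mu (F K n) <= ((K.*2.+1)%:R * 2 * D * rho ^+ n)%:E)%E.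
  have rn0 : 0 <= D * rho ^+ n / n%:R by rewrite divr_ge0.
  apply: (@le_trans _ _
    (\sum_(i < (K * n).*2.+1) mu (ball (ctr K n i) (D * rho ^+ n / n%:R)))%E).
    apply: (Boole_inequality lebesgue_measure
      (A := fun i => ball (ctr K n i) (D * rho ^+ n / n%:R))) => i _.
    exact: measurable_ball.
  under eq_bigr do rewrite lebesgue_measure_ball//.
  rewrite sumEFin lee_fin sumr_const card_ord.
  rewrite -[X in X <= _]mulr_natr -[_ *+ 2]mulr_natr.
  (* For [n = 0] the radius is 0, since the inverse of 0 is 0. *)
  have [->|n0] := posnP n.
    by rewrite invr0 !(mulr0, mul0r) expr0 mulr1 !mulr_ge0// ltW.
  have n1 : 1 <= n%:R :> R by rewrite ler1n.
  rewrite -[leRHS](mulfK (x := n%:R)) ?pnatr_eq0 -?lt0n//.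
  rewrite [leLHS](_ : _ = (2 * (D * rho ^+ n) * ((K * n).*2.+1)%:R) / n%:R);
    last by ring.
  apply: ler_wpM2r; first by rewrite invr_ge0.
  (* For [n >= 1] there are [2 K n + 1 <= (2 K + 1) n] balls, which absorbs the [1 / n] in the
     radius. *)
  rewrite [leRHS](_ : _ = (2 * (D * rho ^+ n) * (K.*2.+1 * n)%:R)); last first.
    by rewrite natrM; ring.
  apply: ler_wpM2l; first by rewrite mulr_ge0.
  by rewrite ler_nat -addn1 -[K.*2.+1]addn1 mulnDl mul1n -doubleMl leq_add2l.
have null K : mu (lim_sup_set (F K)) = 0%E.
  apply: (lim_sup_set_cvg0 (mu := lebesgue_measure)); first exact: mF.
  apply: (@nneseries_geometric_lty _ ((K.*2.+1)%:R * 2 * D) rho) => //;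
    last exact: muF.
  by rewrite !mulr_ge0// ltW.
have negF : mu.-negligible (\bigcup_K lim_sup_set (F K)).
  apply: negligible_bigcup => k; exists (lim_sup_set (F k)).
  split; [|exact: null|by []].
  by apply: bigcapT_measurable => n; apply: bigcup_measurable => i _; exact: mF.
apply: (negligibleS _ negF) => x /= xP.
(* Chosen so that [2 pi |j| <= n (|x| + |psi| + 2 pi) <= K n] for the nearest multiple [2 pi j]. *)
pose K := (Num.truncn (`|x| + `|psi| + pi *+ 2)).+1.
have KP : `|x| + `|psi| + pi *+ 2 <= K%:R by rewrite ltW// truncnS_gt.
exists K => // N _; apply: contra_notP xP => xP.
(* Starting at [N.+1] excludes [n = 0], where the centres are degenerate. *)
exists N.+1 => // n /= Nn; rewrite ltNge; apply/negP => cosle; apply: xP.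
exists n; first exact: ltnW.
have n0 : (0 < n)%N by exact: leq_trans Nn.
have n1 : 1 <= n%:R :> R by rewrite ler1n.
have [j jP] := dist_int2pi_le (n%:R * x + psi + pi).
have := cP _ jP; set u := _ - j%:~R * _ in jP *.
have -> : cos u = - cos (n%:R * x + psi).
  by rewrite /u -mulNr -intrN cosD_int2pi cosDpi.
rewrite opprK => cu.
have ule : `|u| < D * rho ^+ n.
  apply: (@le_lt_trans _ _ (Num.sqrt (C / c) * rho ^+ n)); last first.
    by rewrite ltr_pM2r ?exprn_gt0// ltrDl.
  rewrite -(ler_pXn2r (n := 2))// ?nnegrE//; last first.
    by rewrite mulr_ge0 ?sqrtr_ge0// exprn_ge0// ltW.
  rewrite real_normK ?num_real// exprMn sqr_sqrtr ?divr_ge0 ?(ltW c0)//.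
  rewrite -exprM mulnC exprM sqr_sqrtr ?(ltW om0)//.
  by rewrite mulrAC ler_pdivlMr// mulrC; exact: le_trans cu cosle.
have jK : `|j%:~R : R| <= (K * n)%:R.
  rewrite natrM; have : `|j%:~R * (pi *+ 2)| <= pi + `|n%:R * x + psi + pi|.
    rewrite -lerBlDr; apply: le_trans jP; rewrite /u distrC; exact: lerB_dist.
  have : `|n%:R * x + psi + pi| <= n%:R * `|x| + `|psi| + pi.
    rewrite (le_trans (ler_normD _ _))// (ger0_norm (ltW pi0)) lerD2r.
    by rewrite (le_trans (ler_normD _ _))// normrM ger0_norm.
  rewrite normrM (ger0_norm (x := pi *+ 2)); last by rewrite mulrn_wge0// ltW.
  have := normr_ge0 x; have := normr_ge0 psi; have := normr_ge0 (j%:~R : R).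
  nra.
have jK0 : (0 <= j + (K * n)%:Z)%R.
  rewrite -(ler_int R) intrD -pmulrn addrC -lerBlDl sub0r.
  by move: jK; rewrite ler_norml => /andP[].
rewrite /F -(bigcup_mkord _ (fun i => ball (ctr K n i) (D * rho ^+ n / n%:R))).
exists (absz (j + (K * n)%:Z)) => /=.
  rewrite ltnS -lez_nat gez0_abs// -addnn PoszD lerD2r.
  rewrite -(ler_int R) -pmulrn.
  by move: jK; rewrite ler_norml => /andP[].
rewrite /ball/= /ctr natr_absz (ger0_norm jK0) intrD -pmulrn.
rewrite (_ : _ - x = - u / n%:R); last first.
  by rewrite /u; field; rewrite gt_eqF// ltr0n.
rewrite normrM normrN normfV (ger0_norm (x := n%:R))//.
by rewrite ltr_pM2r// invr_gt0 ltr0n.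
Qed.

End exponential_approach.

(** * From one coordinate to tuples, and infinite sets of times *)

#[local] Instance lebesgue_tuple_ae_filter (R : realType) m :
  Filter (nbhs (almost_everywhere (lebesgue_tuple R m))).
Proof. exact: (ae_filter_ringOfSetsType (lebesgue_tuple R m)). Qed.

(** The exceptional set lies in a box with one null side and all others the whole line; its measure
    is 0 because [0 * +oo = 0]. *)
Lemma ae_tnth (R : realType) m (k : 'I_m) (P : R -> Prop) :
  {ae lebesgue_measure, forall x, P x} ->
  {ae lebesgue_tuple R m, forall t : m.-tuple R, P (tnth t k)}.
Proof.
move=> [N [mN N0 PN]].
pose A j : set (measurableTypeR R) := if j == k then N else setT.
have mA j : measurable (A j) by rewrite /A; case: ifP.
exists [set t : m.-tuple _ | forall j, A j (tnth t j)]; split.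
- exact: measurable_tuple_box.
- rewrite lebesgue_tuple_box// (bigD1 k)//= {1}/A eqxx.
  by rewrite [lebesgue_measure N]N0 mul0e.
- move=> t /= nPt j; rewrite /A; case: eqP => [->|//].
  exact: PN.
Qed.

Lemma infinite_set_nat (A : set nat) :
  (forall N, exists2 n, (N <= n)%N & A n) -> infinite_set A.
Proof.
move=> Aio /finite_seqP[X AX].
have [n] := Aio (\max_(i <- X) i).+1; rewrite AX /= => + nX; apply/negP.
by rewrite -leqNgt (@leq_bigmax_seq _ _ xpredT id).
Qed.

(** * Positivity and oscillation of the sequence *)

Section sine_sum.
Context {R : realType}.
Context (m : nat) (w phi : 'I_m -> R) (r : nat -> R) (omega : R)
  (omega0 : 0 < omega) (omega1 : omega < 1)
  (r_omega : r =O_\oo (fun n => omega ^+ n)) (w_neq0 : forall k, w k != 0).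

Let W := \sum_(k < m) `|w k|.

Lemma remainder_geometric_le :
  exists2 C, 0 <= C & \forall n \near \oo, `|r n| <= C * omega ^+ n.
Proof.
have [C C0 rC] := (eqO_exP _ _ _).1 r_omega.
exists C; first exact: ltW.
apply: filterS rC => n; rewrite (ger0_norm (x := omega ^+ n))//.
by rewrite exprn_ge0// ltW.
Qed.

Lemma remainder_lt e : 0 < e -> \forall n \near \oo, `|r n| < e.
Proof.
move=> e0; have [C C0 rC] := remainder_geometric_le.
have om1 : `|omega| < 1 by rewrite gtr0_norm.
have /cvgrPdist_lt/(_ _ e0) := cvg_geometric C om1.
apply: filterS2 rC => n /= rC; rewrite sub0r normrN => Ce.
exact: le_lt_trans (le_trans rC (ler_norm _)) Ce.
Qed.

Lemma sine_sum_seq_pos_lt1 (theta : m.-tuple R) :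
  W < 1 -> \forall n \near \oo, 0 < sine_sum_seq w phi r theta n.
Proof.
move=> W1; have := @remainder_lt (1 - W); rewrite subr_gt0 => /(_ W1).
apply: filterS => n rn; rewrite /sine_sum_seq.
set s := \sum_(k < m) _; have : `|s| <= W.
  rewrite (le_trans (ler_norm_sum _ _ _))//; apply: ler_sum => k _.
  by rewrite normrM ler_piMr// ler_norml sin_geN1 sin_le1.
move: rn; rewrite ltr_norml ler_norml; lra.
Qed.

Lemma sine_sum_seq_pos_eq1 : (0 < m)%N -> W = 1 ->
  {ae lebesgue_tuple R m, forall theta,
    \forall n \near \oo, 0 < sine_sum_seq w phi r theta n}.
Proof.
(* All terms [|w k| (1 + cos ...)] are nonnegative, so a single one beating the remainder
   suffices. *)
move=> m0 W1; pose k0 := Ordinal m0.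
have w0 : 0 < `|w k0| by rewrite normr_gt0.
have [psi psiP] := sin_amplitude_phases w phi.
have [C C0 rC] := remainder_geometric_le.
have C0w : 0 <= C / `|w k0| by rewrite divr_ge0.
have := ae_tnth k0 (ae_cos_gt_geometric (psi k0) C0w omega0 omega1).
apply: filterS => theta; apply: filterS2 rC => n rn.
rewrite mulrAC ltr_pdivrMr// mulrC => Cn.
have -> : sine_sum_seq w phi r theta n =
    \sum_(k < m) `|w k| * (1 + cos (n%:R * tnth theta k + psi k)) + r n.
  rewrite /sine_sum_seq -[X in _ + X + _]W1 -big_split/=; congr (_ + _).
  by apply: eq_bigr => k _; rewrite psiP; ring.
rewrite (bigD1 k0)//=; set s := \sum_(k < m | _) _.
have : 0 <= s.
  by apply: sumr_ge0 => k _; rewrite mulr_ge0// -lerBlDl sub0r cos_geN1.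
by move: rn; rewrite ler_norml; lra.
Qed.

Lemma ae_sine_sum_gt_io e : 0 < e ->
  {ae lebesgue_tuple R m, forall theta : m.-tuple R,
    forall N, exists2 n, (N <= n)%N &
      W - e < \sum_(k < m) w k * sin (n%:R * tnth theta k + phi k)}.
Proof.
move=> e0; have [psi psiP] := sin_amplitude_phases w phi.
have W0 : 0 <= W by exact: sumr_ge0.
(* The total loss is [W e / (W + 1) < e]; the [+ 1] covers [W = 0]. *)
have d0 : 0 < e / (W + 1) by rewrite divr_gt0// ltr_wpDl.
have := @ae_tuple_cos_gt_io R m setT psi _ d0
  (fun N => ex_intro2 _ _ N (leqnn N) I).
apply: filterS => theta Hio N; have [n Nn [_ Hn]] := Hio N; exists n => //.
apply: (@lt_le_trans _ _ (\sum_(k < m) `|w k| * (1 - e / (W + 1)))).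
  rewrite -mulr_suml -/W mulrBr mulr1 ltrD2l ltrN2 mulrA ltr_pdivrMr
    ?ltr_wpDl//.
  by rewrite mulrC ltr_pM2l// ltrDl.
by apply: ler_sum => k _; rewrite psiP ler_wpM2l// ltW.
Qed.

End sine_sum.

Lemma sine_sum_seq_oscillates (R : realType) m (w phi : 'I_m -> R)
    (r : nat -> R) (omega : R) :
  0 < omega -> omega < 1 -> r =O_\oo (fun n => omega ^+ n) ->
  \sum_(k < m) `|w k| > 1 ->
  {ae lebesgue_tuple R m, forall theta,
    oscillates (sine_sum_seq w phi r theta)}.
Proof.
move=> om0 om1 rO W1.
pose W := \sum_(k < m) `|w k|.
have WN : \sum_(k < m) `|- w k| = W by apply: eq_bigr => k _; rewrite normrN.
(* The sum's defect and the remainder each get half of the gap: in the negative case,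
   [a n < -W + e + 1 + e = 0] with [e = (W - 1) / 2]. *)
have e0 : 0 < (W - 1) / 2 by rewrite divr_gt0// subr_gt0.
have [M _ rM] := remainder_lt om0 om1 rO e0.
have io_pos := ae_sine_sum_gt_io w phi e0.
have := ae_sine_sum_gt_io (fun k => - w k) phi e0; rewrite WN => io_neg.
apply: filterS2 io_pos io_neg => theta pos neg.
split; apply: infinite_set_nat => N.
- have [n] := pos (maxn M N); rewrite geq_max => /andP[Mn Nn] Hn.
  exists n => //=.
  have := rM n Mn; rewrite /sine_sum_seq ltr_norml; rewrite -/W in Hn; lra.
- have [n] := neg (maxn M N); rewrite geq_max => /andP[Mn Nn] Hn.
  exists n => //=.
  move: Hn; under eq_bigr do rewrite mulNr.
  have := rM n Mn; rewrite sumrN /sine_sum_seq ltr_norml; lra.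
Qed.

Theorem theorem7p2 (R : realType) (m : nat) (w phi : 'I_m -> R)
    (r : nat -> R) (omega : R) :
  (1 <= m)%N ->
  (forall k, w k != 0) ->
  0 < omega -> omega < 1 ->
  r =O_\oo (fun n => omega ^+ n) ->
  [/\ \sum_(k < m) `|w k| < 1 ->
        forall theta : m.-tuple R,
          \forall n \near \oo, 0 < sine_sum_seq w phi r theta n,
      \sum_(k < m) `|w k| = 1 ->
        {ae lebesgue_tuple R m, forall theta,
          \forall n \near \oo, 0 < sine_sum_seq w phi r theta n}
    & \sum_(k < m) `|w k| > 1 ->
        {ae lebesgue_tuple R m, forall theta,
          oscillates (sine_sum_seq w phi r theta)}].
Proof.
move=> m1 w0 om0 om1 rO; split.
- by move=> W1 theta; exact: sine_sum_seq_pos_lt1 om0 om1 rO _ W1.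
- by move=> W1; exact: sine_sum_seq_pos_eq1 om0 om1 rO w0 m1 W1.
- exact: sine_sum_seq_oscillates om0 om1 rO.
Qed.
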